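(* If a sequence of probability distributions $\{\mu_m\}$ on $\mathbb{R}$ is computable, then the corresponding sequence of characteristic functions $\{\varphi_m\}$, $\varphi_m(t)=\int_{\mathbb{R}} e^{itx}\,\mu_m(dx)$, is uniformly computable; that is, $\{\varphi_m(t_n)\}$ is a computable double sequence of complex numbers for every computable sequence of reals $\{t_n\}$, and there is a recursive function $\beta(m,k)$ such that $|t-s|<2^{-\beta(m,k)}$ implies $|\varphi_m(t)-\varphi_m(s)|<2^{-k}$ for all $t,s\in\mathbb{R}$.
   Context: A probability distribution is a Borel probability measure $\mu$ on $\mathbb{R}$; $\mu(f)=\int f\,d\mu$. A complex number is computable iff its real and imaginary parts are computable reals. Computability of real functions is in the sense of Pour-El and Richards: $\{f_n\}$ is computable if (i) for every computable sequence of reals $\{x_j\}$, $\{f_n(x_j)\}$ is a computable double sequence, and (ii) there is a recursive $\alpha(n,L,k)$ with $|x-y|<2^{-\alpha(n,L,k)}$, $|x|,|y|\le L$ implying $|f_n(x)-f_n(y)|<2^{-k}$. $\{f_n\}$ is computable with compact support if it is computable and there is a recursive $L(n)$ with $f_n(x)=0$ for $|x|\ge L(n)$. A sequence $\{\mu_m\}$ is computable if $\{\mu_m(f_n)\}$ is a computable double sequence of reals for every computable $\{f_n\}$ with compact support. *)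

(* Defs.v *)
From mathcomp Require Import all_boot all_order all_algebra.
From mathcomp Require Import complex.
From mathcomp Require Import all_classical all_reals all_analysis.

Set Implicit Arguments.
Unset Strict Implicit.
Unset Printing Implicit Defensive.

Import Order.TTheory GRing.Theory Num.Theory.
Local Open Scope ring_scope.
Local Open Scope complex_scope.

(* Total recursive functions: the least class containing the initial functions
   and closed under composition, primitive recursion and minimization of
   regular functions (those f with, for every v, some y such that
   f (y, v) = 0). The defining equations are premises on h, so the class is
   closed under extensional equality. *)
Inductive recursive : forall n : nat, (n.-tuple nat -> nat) -> Prop :=
| recursive_zero n (h : n.-tuple nat -> nat) :
    (forall v, h v = 0%N) -> recursive h
| recursive_succ (h : 1.-tuple nat -> nat) :
    (forall v, h v = (thead v).+1) -> recursive h
| recursive_proj n (i : 'I_n) (h : n.-tuple nat -> nat) :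
    (forall v, h v = tnth v i) -> recursive h
| recursive_comp m n (f : m.-tuple nat -> nat)
    (g : 'I_m -> n.-tuple nat -> nat) (h : n.-tuple nat -> nat) :
    recursive f -> (forall i, recursive (g i)) ->
    (forall v, h v = f [tuple g i v | i < m]) -> recursive h
| recursive_prim n (f : n.-tuple nat -> nat) (g : n.+2.-tuple nat -> nat)
    (h : n.+1.-tuple nat -> nat) :
    recursive f -> recursive g ->
    (forall v : n.-tuple nat, h [tuple of 0%N :: v] = f v) ->
    (forall (y : nat) (v : n.-tuple nat), h [tuple of y.+1 :: v] =
       g [tuple of y :: h [tuple of y :: v] :: v]) -> recursive h
| recursive_min n (f : n.+1.-tuple nat -> nat) (h : n.-tuple nat -> nat) :
    recursive f ->
    (forall v : n.-tuple nat, f [tuple of h v :: v] = 0%N) ->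
    (forall (v : n.-tuple nat) (y : nat), (y < h v)%N -> f [tuple of y :: v] <> 0%N) ->
    recursive h.

Definition uncurry1 (T : Type) (f : nat -> T) (v : 1.-tuple nat) : T :=
  f (nth 0%N v 0).
Definition uncurry2 (T : Type) (f : nat -> nat -> T) (v : 2.-tuple nat) : T :=
  f (nth 0%N v 0) (nth 0%N v 1).
Definition uncurry3 (T : Type) (f : nat -> nat -> nat -> T)
  (v : 3.-tuple nat) : T := f (nth 0%N v 0) (nth 0%N v 1) (nth 0%N v 2).

(* Multi-indexed sequences are indexed by tuples of naturals. *)
Definition computable_rats (n : nat) (r : n.-tuple nat -> rat) : Prop :=
  exists s a b : n.-tuple nat -> nat,
    [/\ recursive s, recursive a, recursive b &
        forall v, b v <> 0%N /\ r v = (-1) ^+ s v * ((a v)%:R / (b v)%:R)].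

(* r (k, v) converges to x v as k tends to infinity, with a recursive modulus
   of convergence e (N, v). *)
Definition computable_reals (R : realType) (n : nat) (x : n.-tuple nat -> R) :
    Prop :=
  exists (r : n.+1.-tuple nat -> rat) (e : n.+1.-tuple nat -> nat),
    [/\ computable_rats r, recursive e &
        forall (v : n.-tuple nat) (N k : nat), (e [tuple of N :: v] <= k)%N ->
          `|ratr (r [tuple of k :: v]) - x v| <= 2 ^- N].

Definition computable_seq (R : realType) (x : nat -> R) : Prop :=
  computable_reals (uncurry1 x).

Definition computable_dseq (R : realType) (x : nat -> nat -> R) : Prop :=
  computable_reals (uncurry2 x).

Definition computable_cdseq (R : realType) (z : nat -> nat -> R[i]) : Prop :=
  computable_dseq (fun m n => complex.Re (z m n)) /\
  computable_dseq (fun m n => complex.Im (z m n)).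

Definition computable_funs (R : realType) (f : nat -> R -> R) : Prop :=
  (forall x : nat -> R, computable_seq x ->
     computable_dseq (fun n j => f n (x j))) /\
  (exists alpha : nat -> nat -> nat -> nat, recursive (uncurry3 alpha) /\
     forall (n L k : nat) (x y : R),
       `|x - y| < 2 ^- alpha n L k -> `|x| <= L%:R -> `|y| <= L%:R ->
       `|f n x - f n y| < 2 ^- k).

Definition computable_funs_cpt (R : realType) (f : nat -> R -> R) : Prop :=
  computable_funs f /\
  (exists L : nat -> nat, recursive (uncurry1 L) /\
     forall (n : nat) (x : R), (L n)%:R <= `|x| -> f n x = 0).

Definition computable_distrs (R : realType)
    (mu : nat -> probability (measurableTypeR R) R) : Prop :=
  forall f : nat -> R -> R, computable_funs_cpt f ->
    computable_dseq (fun m n => \int[mu m]_x f n x).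

Definition cexp (R : realType) (z : R[i]) : R[i] :=
  (expR (complex.Re z))%:C *
  (cos (complex.Im z) +i* sin (complex.Im z)).

Definition cintegral (R : realType) (mu : probability (measurableTypeR R) R)
    (f : R -> R[i]) : R[i] :=
  (\int[mu]_x complex.Re (f x)) +i* (\int[mu]_x complex.Im (f x)).

Definition char_fun (R : realType) (mu : probability (measurableTypeR R) R)
    (t : R) : R[i] :=
  cintegral mu (fun x => cexp ('i * t%:C * x%:C)).

(* The norm and order below are those of R[i]: both sides are real, so this is
   the usual strict inequality between moduli and reals. *)
Definition uniformly_computable (R : realType) (phi : nat -> R -> R[i]) :
    Prop :=
  (forall t : nat -> R, computable_seq t ->
     computable_cdseq (fun m n => phi m (t n))) /\
  (exists beta : nat -> nat -> nat, recursive (uncurry2 beta) /\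
     forall (m k : nat) (t s : R),
       `|t - s| < 2 ^- beta m k -> `|phi m t - phi m s| < 2 ^- k).

(* Main.v *)
(* Testing the mu_m against the compactly supported functions tent_L, equal to 1
   on [-L, L], gives mu_m(tent_L), which tends to 1 as L grows; a search for an L
   at which a rational approximation is close to 1 yields a recursive L(m, k)
   with 1 - mu_m(tent_L(m,k)) <= 2^-k. Then mu_m(tent_L(m,k) cos(t_n x)) is
   computable, uniformly in m, n, k, and within 2^-k of Re phi_m(t_n); and
   |mu_m(cos(t x)) - mu_m(cos(s x))| <= (L + 1) |t - s| + 2 (1 - mu_m(tent_L))
   gives the modulus of continuity. The same holds for sin and Im phi_m. *)

Require Import Defs.
From mathcomp Require Import all_boot all_order all_algebra.
From mathcomp Require Import complex.
From mathcomp Require Import all_classical all_reals all_analysis measurable_realfun.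
From mathcomp Require Import zify ring lra.

Set Implicit Arguments.
Unset Strict Implicit.
Unset Printing Implicit Defensive.

Import Order.TTheory GRing.Theory Num.Theory numFieldNormedType.Exports.

(** * Recursive functions *)

(** Two obstacles lie outside the estimates. A sequence of test functions carries one index and
    cannot depend on [m], whereas the cut-off [L(m,k)] does; so the test functions are indexed by a
    code of the pair [(n, L)] with [L] arbitrary, and [L(m,k)] is substituted afterwards in the
    computable double sequence of integrals. Moreover, evaluating the test functions at computable
    points needs cosine and sine of computable reals, down to recursive functions on tuples of
    naturals. No power series is summed: cosine comes from its quadratic Taylor polynomial at a tiny
    argument followed by repeated angle doubling, and sine is, up to sign, a limit of symmetric
    difference quotients of cosine. *)

Lemma eq_recursive n (f g : n.-tuple nat -> nat) :
  f =1 g -> recursive f -> recursive g.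
Proof. by move=> /funext ->. Qed.

(** Components are indexed by all of [nat], with value 0 out of range, so that cons and behead
    merely shift the index and no ordinals have to be cast. *)
Definition recursive_map m n (G : n.-tuple nat -> m.-tuple nat) : Prop :=
  forall i, recursive (fun v => nth 0 (G v) i).

Lemma recursive0 n : recursive (fun _ : n.-tuple nat => 0).
Proof. exact: recursive_zero. Qed.

Lemma recursive_nth n i : recursive (fun v : n.-tuple nat => nth 0 v i).
Proof.
have [lt_in|le_ni] := ltnP i n.
  by apply: (recursive_proj (i := Ordinal lt_in)) => v; rewrite (tnth_nth 0).
by apply: recursive_zero => v; rewrite nth_default ?size_tuple.
Qed.

Lemma recursive_thead n : recursive (fun v : n.+1.-tuple nat => thead v).
Proof. exact: (recursive_proj (i := ord0)). Qed.

Lemma recursive_map_comp m n (f : m.-tuple nat -> nat)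
    (G : n.-tuple nat -> m.-tuple nat) :
  recursive f -> recursive_map G -> recursive (fun v => f (G v)).
Proof.
move=> rf rG; apply: (recursive_comp (g := fun i v => tnth (G v) i) rf).
  by move=> i; apply: eq_recursive (rG i) => v; rewrite (tnth_nth 0).
by move=> v; congr f; apply: eq_from_tnth => i; rewrite tnth_mktuple.
Qed.

Lemma recursive_map_cons m n (g : n.-tuple nat -> nat)
    (G : n.-tuple nat -> m.-tuple nat) :
  recursive g -> recursive_map G ->
  recursive_map (fun v => [tuple of g v :: G v]).
Proof. by move=> rg rG [|i]; [exact: rg | exact: rG]. Qed.

Lemma recursive_map_nil n : recursive_map (fun _ : n.-tuple nat => [tuple]).
Proof. by move=> i; apply: recursive_zero => v; rewrite nth_nil. Qed.

Lemma recursive_map_id n : recursive_map (fun v : n.-tuple nat => v).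
Proof. exact: recursive_nth. Qed.

Lemma recursive_map_behead n :
  recursive_map (fun v : n.+1.-tuple nat => [tuple of behead v]).
Proof.
by move=> i; apply: eq_recursive (recursive_nth _ i.+1) => v; rewrite /= nth_behead.
Qed.

Lemma recursive1 n (f : nat -> nat) (g : n.-tuple nat -> nat) :
  recursive (uncurry1 f) -> recursive g -> recursive (fun v => f (g v)).
Proof.
move=> rf rg.
exact: recursive_map_comp rf (recursive_map_cons rg (@recursive_map_nil n)).
Qed.

Lemma recursive2 n (f : nat -> nat -> nat) (g1 g2 : n.-tuple nat -> nat) :
  recursive (uncurry2 f) -> recursive g1 -> recursive g2 ->
  recursive (fun v => f (g1 v) (g2 v)).
Proof.
move=> rf r1 r2; exact: recursive_map_comp rf
  (recursive_map_cons r1 (recursive_map_cons r2 (@recursive_map_nil n))).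
Qed.

Lemma recursive3 n (f : nat -> nat -> nat -> nat)
    (g1 g2 g3 : n.-tuple nat -> nat) :
  recursive (uncurry3 f) -> recursive g1 -> recursive g2 -> recursive g3 ->
  recursive (fun v => f (g1 v) (g2 v) (g3 v)).
Proof.
move=> rf r1 r2 r3; exact: recursive_map_comp rf
  (recursive_map_cons r1 (recursive_map_cons r2
    (recursive_map_cons r3 (@recursive_map_nil n)))).
Qed.

Lemma recursiveS n (g : n.-tuple nat -> nat) :
  recursive g -> recursive (fun v => (g v).+1).
Proof.
by apply: recursive1; apply: recursive_succ => v; rewrite /uncurry1 /thead (tnth_nth 0).
Qed.

Lemma recursive_cst n (c : nat) : recursive (fun _ : n.-tuple nat => c).
Proof. by elim: c => [|c]; [exact: recursive0 | exact: recursiveS]. Qed.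

Lemma recursive_rec2 (F : nat -> nat -> nat) f g :
  recursive (uncurry1 f) -> recursive (uncurry3 g) ->
  (forall b, F 0 b = f b) -> (forall a b, F a.+1 b = g a (F a b) b) ->
  recursive (uncurry2 F).
Proof.
by move=> rf rg F0 FS; apply: (recursive_prim rf rg) => *; [exact: F0|exact: FS].
Qed.

Lemma recursiveD n (f g : n.-tuple nat -> nat) :
  recursive f -> recursive g -> recursive (fun v => f v + g v).
Proof.
apply: recursive2; apply: (@recursive_rec2 _ id (fun _ c _ => c.+1)) => //.
- exact: recursive_nth.
- exact/recursiveS/recursive_nth.
Qed.

Lemma recursiveM n (f g : n.-tuple nat -> nat) :
  recursive f -> recursive g -> recursive (fun v => f v * g v).
Proof.
apply: recursive2.
apply: (@recursive_rec2 _ (fun=> 0) (fun _ c b => c + b)) => //.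
- exact: recursive0.
- by apply: recursiveD; apply: recursive_nth.
- by move=> a b; rewrite mulSn addnC.
Qed.

Lemma recursive_pred n (f : n.-tuple nat -> nat) :
  recursive f -> recursive (fun v => (f v).-1).
Proof.
move=> rf.
have r2 : recursive (uncurry2 (fun a _ => a.-1)).
  apply: (@recursive_rec2 _ (fun=> 0) (fun a _ _ => a)) => //.
  - exact: recursive0.
  - exact: recursive_nth.
exact: (recursive2 r2 rf (recursive0 n)).
Qed.

Lemma recursiveB n (f g : n.-tuple nat -> nat) :
  recursive f -> recursive g -> recursive (fun v => f v - g v).
Proof.
(* Primitive recursion runs on the leading argument, so the subtrahend is put there. *)
move=> rf rg; apply: (@recursive2 _ (fun a b => b - a)) rg rf.
apply: (@recursive_rec2 _ id (fun _ c _ => c.-1)) => //.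
- exact: recursive_nth.
- exact/recursive_pred/recursive_nth.
- by move=> b; rewrite subn0.
- by move=> a b; rewrite subnS.
Qed.

Lemma recursiveX n (f g : n.-tuple nat -> nat) :
  recursive f -> recursive g -> recursive (fun v => f v ^ g v).
Proof.
move=> rf rg; apply: (@recursive2 _ (fun a b => b ^ a)) rg rf.
apply: (@recursive_rec2 _ (fun=> 1) (fun _ c b => b * c)) => //.
- exact: recursive_cst.
- by apply: recursiveM; apply: recursive_nth.
- by move=> a b; rewrite expnS.
Qed.

Lemma recursive_odd n (f : n.-tuple nat -> nat) :
  recursive f -> recursive (fun v => odd (f v) : nat).
Proof.
move=> rf.
have r2 : recursive (uncurry2 (fun a _ => odd a : nat)).
  apply: (@recursive_rec2 _ (fun=> 0) (fun _ c _ => 1 - c)) => //.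
  - exact: recursive0.
  - exact: recursiveB (recursive_cst _ 1) (recursive_nth _ 1).
  - by move=> a _ /=; case: odd.
exact: (recursive2 r2 rf (recursive0 n)).
Qed.

Lemma recursive_distn n (f g : n.-tuple nat -> nat) :
  recursive f -> recursive g -> recursive (fun v => f v - g v + (g v - f v)).
Proof. by move=> rf rg; apply: recursiveD; apply: recursiveB. Qed.

Lemma recursive_leq n (f g : n.-tuple nat -> nat) :
  recursive f -> recursive g -> recursive (fun v => (f v <= g v) : nat).
Proof.
move=> rf rg; apply: (@eq_recursive _ (fun v => 1 - (f v - g v))).
  by move=> v; rewrite -subn_eq0; case: (f v - g v).
exact: recursiveB (recursive_cst _ 1) (recursiveB rf rg).
Qed.

(** Unbounded search enters here: [1 - P] vanishes exactly where [P] holds, and [ex_minn] is its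
    least zero. *)
Lemma recursive_ex_minn n (P : nat -> n.-tuple nat -> bool)
    (exP : forall v, exists y, P y v) :
  recursive (fun v : n.+1.-tuple nat => P (thead v) [tuple of behead v] : nat) ->
  recursive (fun v => ex_minn (exP v)).
Proof.
have tailE y (v : n.-tuple nat) : [tuple of behead [tuple of y :: v]] = v.
  exact: val_inj.
move=> rP; apply: (recursive_min (f := fun v : n.+1.-tuple nat =>
    1 - P (thead v) [tuple of behead v])).
- exact: recursiveB (recursive_cst _ 1) rP.
- by move=> v; rewrite theadE tailE; case: ex_minnP => y ->.
- move=> v y; case: ex_minnP => z _ zmin; rewrite theadE tailE ltnNge => /negP yz.
  by case Py : (P y v) => //; case: yz; apply: zmin.
Qed.

(** * A recursive pairing *)

(* [(a + b) ^ 2 <= pairn a b < (a + b).+1 ^ 2], so that [sqrtn] recovers [a + b]. *)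
Definition pairn (a b : nat) : nat := (a + b) ^ 2 + a.

Lemma ex_sqrtn z : exists y, z < y.+1 ^ 2.
Proof. by exists z; rewrite expnS expn1; lia. Qed.

Definition sqrtn (z : nat) : nat := ex_minn (ex_sqrtn z).
Definition unpair1 (z : nat) : nat := z - sqrtn z ^ 2.
Definition unpair2 (z : nat) : nat := sqrtn z - unpair1 z.

Lemma sqrtn_pairn a b : sqrtn (pairn a b) = a + b.
Proof.
rewrite /sqrtn; case: ex_minnP => y lt_y min_y; apply/eqP; rewrite eqn_leq.
apply/andP; split; first by apply: min_y; rewrite /pairn !expnS !expn0; lia.
rewrite leqNgt; apply/negP => lt_ab; move: lt_y; rewrite ltnNge => /negP; apply.
apply: (@leq_trans ((a + b) ^ 2)); last exact: leq_addr.
by rewrite leq_exp2r.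
Qed.

Lemma pairnK1 a b : unpair1 (pairn a b) = a.
Proof. by rewrite /unpair1 sqrtn_pairn /pairn addKn. Qed.

Lemma pairnK2 a b : unpair2 (pairn a b) = b.
Proof. by rewrite /unpair2 pairnK1 sqrtn_pairn addKn. Qed.

Lemma recursive_pairn n (f g : n.-tuple nat -> nat) :
  recursive f -> recursive g -> recursive (fun v => pairn (f v) (g v)).
Proof.
move=> rf rg; apply: recursiveD (rf).
exact: recursiveX (recursiveD rf rg) (recursive_cst _ 2).
Qed.

Lemma recursive_sqrtn n (f : n.-tuple nat -> nat) :
  recursive f -> recursive (fun v => sqrtn (f v)).
Proof.
apply: recursive1.
apply: (@recursive_ex_minn 1 (fun y v => nth 0 v 0 < y.+1 ^ 2)
  (fun v => ex_sqrtn (nth 0 v 0))).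
apply: (@eq_recursive _ (fun v => (nth 0 v 1).+1 <= (nth 0 v 0).+1 ^ 2 : nat)).
  by move=> v; rewrite /thead (tnth_nth 0) /= nth_behead.
apply: recursive_leq; first exact/recursiveS/recursive_nth.
exact: recursiveX (recursiveS (recursive_nth _ _)) (recursive_cst _ 2).
Qed.

Lemma recursive_unpair1 n (f : n.-tuple nat -> nat) :
  recursive f -> recursive (fun v => unpair1 (f v)).
Proof.
move=> rf; apply: recursiveB (rf) _.
exact: recursiveX (recursive_sqrtn rf) (recursive_cst _ 2).
Qed.

Lemma recursive_unpair2 n (f : n.-tuple nat -> nat) :
  recursive f -> recursive (fun v => unpair2 (f v)).
Proof.
move=> rf; apply: recursiveB; first exact: recursive_sqrtn.
exact: recursive_unpair1.
Qed.

(** * Computable reals *)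

Local Open Scope ring_scope.

Section ComputableReals.
Context {R : realType}.

(* A sign-free form of [computable_rats], with values in [R]. *)
Definition recursive_frac n (r : n.-tuple nat -> R) : Prop :=
  exists p q b : n.-tuple nat -> nat,
    [/\ recursive p, recursive q, recursive b &
        forall v, (0 < b v)%N /\ r v = ((p v)%:R - (q v)%:R) / (b v)%:R].

Lemma recursive_frac_map m n (r : m.-tuple nat -> R)
    (G : n.-tuple nat -> m.-tuple nat) :
  recursive_frac r -> recursive_map G -> recursive_frac (fun v => r (G v)).
Proof.
move=> [p [q [b [rp rq rb rE]]]] rG.
exists (fun v => p (G v)), (fun v => q (G v)), (fun v => b (G v)).
by split=> //; exact: recursive_map_comp.
Qed.

Lemma recursive_fracD n (r s : n.-tuple nat -> R) :
  recursive_frac r -> recursive_frac s -> recursive_frac (fun v => r v + s v).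
Proof.
move=> [p [q [b [rp rq rb rE]]]] [p' [q' [b' [rp' rq' rb' rE']]]].
exists (fun v => p v * b' v + p' v * b v)%N,
  (fun v => q v * b' v + q' v * b v)%N, (fun v => b v * b' v)%N.
split; try by do ?[apply: recursiveD|apply: recursiveM].
move=> v; have [b0 ->] := rE v; have [b0' ->] := rE' v.
split; first by rewrite muln_gt0 b0.
by rewrite !natrD !natrM; field; rewrite !pnatr_eq0 -!lt0n b0 b0'.
Qed.

Lemma recursive_fracM n (r s : n.-tuple nat -> R) :
  recursive_frac r -> recursive_frac s -> recursive_frac (fun v => r v * s v).
Proof.
move=> [p [q [b [rp rq rb rE]]]] [p' [q' [b' [rp' rq' rb' rE']]]].
exists (fun v => p v * p' v + q v * q' v)%N,
  (fun v => q v * p' v + p v * q' v)%N, (fun v => b v * b' v)%N.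
split; try by do ?[apply: recursiveD|apply: recursiveM].
move=> v; have [b0 ->] := rE v; have [b0' ->] := rE' v.
split; first by rewrite muln_gt0 b0.
by rewrite !natrD !natrM; field; rewrite !pnatr_eq0 -!lt0n b0 b0'.
Qed.

(** Subtraction on [nat] is truncated, so one of the two summands is zero. *)
Lemma distn_natr (p q : nat) : (p - q + (q - p))%:R = `|p%:R - q%:R| :> R.
Proof.
have [le_pq|/ltnW le_qp] := leqP p q.
  rewrite (eqP le_pq) add0n natrB // distrC ger0_norm //.
  by rewrite subr_ge0 ler_nat.
by rewrite (eqP le_qp) addn0 natrB // ger0_norm // subr_ge0 ler_nat.
Qed.

Lemma recursive_frac_norm n (r : n.-tuple nat -> R) :
  recursive_frac r -> recursive_frac (fun v => `|r v|).
Proof.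
move=> [p [q [b [rp rq rb rE]]]].
exists (fun v => p v - q v + (q v - p v))%N, (fun=> 0%N), b.
split=> //; [exact: recursive_distn|exact: recursive0|].
move=> v; have [b0 ->] := rE v; split=> //.
by rewrite distn_natr subr0 normrM normfV normr_nat.
Qed.

Lemma recursive_frac_nat n (f : n.-tuple nat -> nat) :
  recursive f -> recursive_frac (fun v => (f v)%:R : R).
Proof.
move=> rf; exists f, (fun=> 0%N), (fun=> 1%N).
split=> // [||v]; [exact: recursive0|exact: recursive_cst|].
by split=> //; rewrite subr0 divr1.
Qed.

Lemma recursive_fracN1 n : recursive_frac (fun _ : n.-tuple nat => -1 : R).
Proof.
exists (fun=> 0%N), (fun=> 1%N), (fun=> 1%N).
by split=> // [||| v]; rewrite ?sub0r ?divr1//; exact: recursive_cst.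
Qed.

Lemma recursive_frac_natV n (f : n.-tuple nat -> nat) :
  recursive f -> (forall v, 0 < f v)%N ->
  recursive_frac (fun v => (f v)%:R^-1 : R).
Proof.
move=> rf f0; exists (fun=> 1%N), (fun=> 0%N), f.
split=> // [||v]; [exact: recursive_cst|exact: recursive0|].
by split=> //; rewrite subr0 div1r.
Qed.

Lemma recursive_frac_bound n (r : n.-tuple nat -> R) :
  recursive_frac r ->
  exists B, recursive B /\ forall v, `|r v| <= (B v)%:R.
Proof.
move=> [p [q [b [rp rq rb rE]]]]; exists (fun v => p v + q v)%N.
split; first exact: recursiveD.
move=> v; have [b0 ->] := rE v; rewrite normrM normfV normr_nat.
rewrite ler_pdivrMr ?ltr0n//.
apply: (@le_trans _ _ (p v + q v)%:R).
  by rewrite natrD (le_trans (ler_normB _ _))// !normr_nat.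
by rewrite ler_peMr// ler1n.
Qed.

(** Only the parity of the sign exponent matters: it sends the numerator to the positive or to the
    negative part. *)
Lemma computable_rats_frac n (r : n.-tuple nat -> rat) :
  computable_rats r -> recursive_frac (fun v => ratr (r v) : R).
Proof.
move=> [s [a [b [rs ra rb rE]]]].
exists (fun v => a v * (1 - odd (s v)))%N, (fun v => a v * odd (s v))%N, b.
split=> //.
- apply: recursiveM => //; apply: recursiveB; first exact: recursive_cst.
  exact: recursive_odd.
- by apply: recursiveM => //; exact: recursive_odd.
- move=> v; have [/eqP b0 ->] := rE v; split; first by rewrite lt0n.
  rewrite -signr_odd rmorphM rmorphXn rmorphN rmorph1 fmorph_div !rmorph_nat.
  rewrite mulrA; case: odd;
    by rewrite ?muln0 ?muln1 ?expr0 ?expr1 ?sub0r ?subr0 ?mulN1r ?mul1r.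
Qed.

Lemma recursive_frac_rats n (r : n.-tuple nat -> R) :
  recursive_frac r ->
  exists2 r' : n.-tuple nat -> rat,
    computable_rats r' & forall v, ratr (r' v) = r v.
Proof.
move=> [p [q [b [rp rq rb rE]]]].
exists (fun v => (-1) ^+ (p v < q v)%N *
  ((p v - q v + (q v - p v))%:R / (b v)%:R)); last first.
  move=> v; have [_ ->] := rE v.
  rewrite rmorphM rmorphXn rmorphN rmorph1 fmorph_div !rmorph_nat distn_natr mulrA.
  congr (_ / _); have [lt_pq|le_qp] := ltnP (p v) (q v).
    by rewrite expr1 mulN1r ltr0_norm ?opprK// subr_lt0 ltr_nat.
  by rewrite expr0 mul1r ger0_norm// subr_ge0 ler_nat.
exists (fun v => (p v < q v)%N : nat), (fun v => p v - q v + (q v - p v))%N, b.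
split=> //; first by apply: recursive_leq => //; exact: recursiveS.
  exact: recursive_distn.
by move=> v; have [/lt0n_neq0/eqP b0 _] := rE v; split.
Qed.

Lemma ltr_nat_exp2 (m : nat) : m%:R < 2 ^+ m :> R.
Proof. by rewrite -natrX ltr_nat ltn_expl. Qed.

(** Since [m < 2 ^ m], a factor [m] is absorbed by [m] further binary digits. Every modulus below is
    obtained in this way, without logarithms. *)
Lemma mulr_nat_exp2V (m N : nat) : m%:R * 2 ^- (N + m) <= 2 ^- N :> R.
Proof.
rewrite exprD invfM mulrCA ler_piMr// ?invr_ge0 ?exprn_ge0//.
by rewrite ler_pdivrMr ?exprn_gt0// mul1r ltW// ltr_nat_exp2.
Qed.

Lemma ler_exp2V (m n : nat) : (m <= n)%N -> 2 ^- n <= 2 ^- m :> R.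
Proof.
by move=> le_mn; rewrite lef_pV2 ?posrE ?exprn_gt0// ler_eXn2l// ltr1n.
Qed.

(** The working criterion for computability: a recursive factor in the error is allowed, as shifting
    the modulus by [M v] absorbs it. *)
Lemma computable_reals_approx n (x : n.-tuple nat -> R)
    (r : n.+1.-tuple nat -> R) (M : n.-tuple nat -> nat) :
  recursive_frac r -> recursive M ->
  (forall (k : nat) (v : n.-tuple nat),
    `|r [tuple of k :: v] - x v| <= (M v)%:R * 2 ^- k) ->
  computable_reals x.
Proof.
move=> /recursive_frac_rats[r' cr' r'E] rM rx.
exists r', (fun w : n.+1.-tuple nat => (nth 0 w 0 + M [tuple of behead w]))%N.
split=> //.
  apply: recursiveD; first exact: recursive_nth.
  exact: recursive_map_comp (@recursive_map_behead n).
move=> v N k; have -> : [tuple of behead [tuple of N :: v]] = v by exact: val_inj.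
rewrite /= r'E => le_k; apply: (le_trans (rx k v)).
apply: le_trans (mulr_nat_exp2V (M v) N).
by rewrite ler_wpM2l// ler_exp2V.
Qed.


Lemma computable_realsP n (x : n.-tuple nat -> R) :
  computable_reals x ->
  exists2 r : n.+1.-tuple nat -> R, recursive_frac r &
    forall (k : nat) (v : n.-tuple nat), `|r [tuple of k :: v] - x v| <= 2 ^- k.
Proof.
move=> [r [e [/computable_rats_frac cr re rx]]].
(* Reindexing the approximations along their own modulus makes the rate exactly [2 ^- k]. *)
exists (fun w => ratr (r [tuple of e w :: behead w])).
  apply: recursive_frac_map cr _.
  by apply: recursive_map_cons => //; exact: recursive_map_behead.
move=> k v; have -> : [tuple of e [tuple of k :: v] :: behead [tuple of k :: v]] =
    [tuple of e [tuple of k :: v] :: v] by exact: val_inj.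
exact: rx.
Qed.

Lemma computable_reals_map m n (x : m.-tuple nat -> R)
    (G : n.-tuple nat -> m.-tuple nat) :
  computable_reals x -> recursive_map G -> computable_reals (fun v => x (G v)).
Proof.
move=> /computable_realsP[r cr rx] rG.
apply: (@computable_reals_approx _ _
  (fun w => r [tuple of thead w :: G [tuple of behead w]]) (fun=> 1%N)).
- apply: recursive_frac_map cr _; apply: recursive_map_cons.
    exact: recursive_thead.
  move=> i; exact: recursive_map_comp (rG i) (@recursive_map_behead n).
- exact: recursive_cst.
- move=> k v; rewrite mul1r theadE.
  by have -> : [tuple of behead [tuple of k :: v]] = v by exact: val_inj.
Qed.

Lemma computable_reals_frac n (x : n.-tuple nat -> R) :
  recursive_frac x -> computable_reals x.
Proof.
move=> cx; apply: (@computable_reals_approx _ _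
  (fun w : n.+1.-tuple nat => x [tuple of behead w]) (fun=> 0%N)).
- exact: recursive_frac_map cx (@recursive_map_behead n).
- exact: recursive0.
- move=> k v; have -> : [tuple of behead [tuple of k :: v]] = v by exact: val_inj.
  by rewrite subrr normr0 mul0r.
Qed.

Lemma computable_reals_nat n (f : n.-tuple nat -> nat) :
  recursive f -> computable_reals (fun v => (f v)%:R : R).
Proof. by move=> rf; apply/computable_reals_frac/recursive_frac_nat. Qed.

Lemma recursive_map_cst_cons n :
  recursive_map (fun v : n.-tuple nat => [tuple of 0%N :: v]).
Proof.
by apply: recursive_map_cons; [exact: recursive0|exact: recursive_map_id].
Qed.

Lemma computable_reals_bound n (x : n.-tuple nat -> R) :
  computable_reals x ->
  exists B, recursive B /\ forall v, `|x v| <= (B v)%:R.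
Proof.
move=> /computable_realsP[r cr rx].
have [B [rB Bx]] := recursive_frac_bound cr.
exists (fun v : n.-tuple nat => (B [tuple of 0%N :: v]).+1); split.
  exact/recursiveS/(recursive_map_comp rB)/recursive_map_cst_cons.
move=> v; rewrite -natr1 -[x v](subrK (r [tuple of 0%N :: v])).
rewrite (le_trans (ler_normD _ _))// addrC lerD// distrC.
by have := rx 0%N v; rewrite expr0 invr1.
Qed.

Lemma computable_realsD n (x y : n.-tuple nat -> R) :
  computable_reals x -> computable_reals y ->
  computable_reals (fun v => x v + y v).
Proof.
move=> /computable_realsP[r cr rx] /computable_realsP[s cs sy].
apply: (computable_reals_approx (recursive_fracD cr cs) (recursive_cst _ 2)).
move=> k v; rewrite opprD addrACA.
by rewrite (le_trans (ler_normD _ _))// mulrDl mul1r lerD.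
Qed.

Lemma computable_realsM n (x y : n.-tuple nat -> R) :
  computable_reals x -> computable_reals y ->
  computable_reals (fun v => x v * y v).
Proof.
move=> cx cy.
have [B [rB xB]] := computable_reals_bound cx.
have [C [rC yC]] := computable_reals_bound cy.
have [r cr rx] := computable_realsP cx.
have [s cs sy] := computable_realsP cy.
(* [(B v).+1] bounds the approximation of [x v], which is off by at most 1, and [C v] bounds
   [y v]. *)
apply: (@computable_reals_approx _ _ _ (fun v => (B v).+1 + C v)%N
  (recursive_fracM cr cs)).
  by apply: recursiveD => //; exact: recursiveS.
move=> k v; set a := r _; set b := s _.
have -> : a * b - x v * y v = a * (b - y v) + y v * (a - x v) by ring.
have aB : `|a| <= (B v).+1%:R.
  rewrite -natr1 -[a](subrK (x v)) (le_trans (ler_normD _ _))// addrC lerD//.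
  by rewrite (le_trans (rx _ _))// invf_le1 ?exprn_gt0// exprn_ege1// ler1n.
rewrite (le_trans (ler_normD _ _))// natrD mulrDl !normrM.
by apply: lerD; apply: ler_pM => //; [exact: sy|exact: rx].
Qed.

Lemma computable_realsN n (x : n.-tuple nat -> R) :
  computable_reals x -> computable_reals (fun v => - x v).
Proof.
move=> cx; under eq_fun do rewrite -mulN1r.
apply: computable_realsM cx; exact/computable_reals_frac/recursive_fracN1.
Qed.

Lemma computable_realsB n (x y : n.-tuple nat -> R) :
  computable_reals x -> computable_reals y ->
  computable_reals (fun v => x v - y v).
Proof. by move=> cx cy; apply: computable_realsD => //; apply: computable_realsN. Qed.

Lemma computable_reals_norm n (x : n.-tuple nat -> R) :
  computable_reals x -> computable_reals (fun v => `|x v|).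
Proof.
move=> /computable_realsP[r cr rx].
apply: (computable_reals_approx (recursive_frac_norm cr) (recursive_cst _ 1)).
by move=> k v; rewrite mul1r (le_trans (ler_dist_dist _ _)).
Qed.

(** Diagonalization: the [k]-th approximation of the [k]-th term has its own error [2 ^- k], which
    raises the factor [M v] by one. *)
Lemma computable_reals_lim n (x : n.+1.-tuple nat -> R) (y : n.-tuple nat -> R)
    (M : n.-tuple nat -> nat) :
  computable_reals x -> recursive M ->
  (forall (k : nat) (v : n.-tuple nat),
    `|x [tuple of k :: v] - y v| <= (M v)%:R * 2 ^- k) ->
  computable_reals y.
Proof.
move=> /computable_realsP[r cr rx] rM xy.
apply: (@computable_reals_approx _ _ (fun w => r [tuple of thead w :: w])
  (fun v => (M v).+1)).
- apply: recursive_frac_map cr _; apply: recursive_map_cons.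
    exact: recursive_thead.
  exact: recursive_map_id.
- exact: recursiveS.
- move=> k v; rewrite theadE -(subrK (x [tuple of k :: v]) (r _)) -addrA.
  rewrite (le_trans (ler_normD _ _))// -natr1 mulrDl [leRHS]addrC mul1r.
  by apply: lerD; [exact: rx|exact: xy].
Qed.

End ComputableReals.

(** * Computability of the trigonometric functions *)

Section Trigonometry.
Context {R : realType}.
Implicit Types x y : R.

Lemma derive_bound_dist (f df : R -> R) (M x y : R) :
  x <= y -> (forall c : R, is_derive c 1 f (df c)) ->
  (forall c, x <= c <= y -> `|df c| <= M) -> `|f y - f x| <= M * (y - x).
Proof.
move=> le_xy fdf dfM; have [|c] := MVT_segment le_xy (fun c _ => fdf c).
  by apply: derivable_within_continuous => c _; have [] := fdf c.
rewrite in_itv/= => cxy ->.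
by rewrite normrM (ger0_norm (_ : 0 <= y - x)) ?subr_ge0// ler_wpM2r ?subr_ge0// dfM.
Qed.

Lemma sin_dist x y : `|sin x - sin y| <= `|x - y|.
Proof.
wlog le_yx : x y / y <= x => [wl|].
  by have [/wl//|/ltW/wl] := leP y x; rewrite distrC [leRHS]distrC.
rewrite (ger0_norm (_ : 0 <= x - y)) ?subr_ge0// -[leRHS]mul1r.
by apply: (@derive_bound_dist _ cos) => // c _; exact: cos_max.
Qed.

Lemma cos_dist x y : `|cos x - cos y| <= `|x - y|.
Proof.
wlog le_yx : x y / y <= x => [wl|].
  by have [/wl//|/ltW/wl] := leP y x; rewrite distrC [leRHS]distrC.
rewrite (ger0_norm (_ : 0 <= x - y)) ?subr_ge0// -[leRHS]mul1r.
by apply: (@derive_bound_dist _ (fun c => - sin c)) => // c _; rewrite normrN sin_max.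
Qed.

Lemma norm_sin_le x : `|sin x| <= `|x|.
Proof. by have := sin_dist x 0; rewrite sin0 !subr0. Qed.

Lemma cos_half x : cos x = 1 - 2 * sin (x / 2) ^+ 2.
Proof.
rewrite {1}(_ : x = (x / 2) *+ 2); last by rewrite -mulr_natr; field.
by rewrite cos_mulr2n cos2sin2; ring.
Qed.

(** The derivative [cos c - 1 = - 2 sin (c / 2) ^ 2] is at most [x ^ 2 / 2] in absolute value for
    [0 <= c <= x]; oddness covers negative [x]. The constant 1/2 is not sharp but suffices. *)
Lemma sin_sub_id x : `|sin x - x| <= `|x| ^+ 3 / 2.
Proof.
wlog x0 : x / 0 <= x => [wl|].
  have [/wl//|/ltW x0] := leP 0 x.
  by have := wl (- x); rewrite oppr_ge0 sinN -opprD !normrN; exact.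
rewrite (ger0_norm x0).
have := @derive_bound_dist (fun x => sin x - x) (fun c => cos c - 1)
  (x ^+ 2 / 2) 0 x x0.
rewrite sin0 !subr0 (_ : x ^+ 2 / 2 * x = x ^+ 3 / 2); last by ring.
apply=> c /andP[c0 cx]; rewrite cos_half.
rewrite (_ : 1 - 2 * _ - 1 = - (2 * sin (c / 2) ^+ 2)); last by ring.
rewrite normrN ger0_norm; last by rewrite mulr_ge0// sqr_ge0.
have := norm_sin_le (c / 2); rewrite (ger0_norm (_ : 0 <= c / 2)); last by lra.
rewrite -(real_normK (num_real (sin _))) => sc.
have s0 := normr_ge0 (sin (c / 2)).
nra.
Qed.

(** With [u = x / 2] the difference factors as [- 2 (sin u - u) (sin u + u)], bounded by
    [2 * (|u| ^ 3 / 2) * (2 |u|) = x ^ 4 / 8]. *)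
Lemma cos_sub_taylor2 x : `|cos x - (1 - x ^+ 2 / 2)| <= x ^+ 4 / 8.
Proof.
rewrite cos_half; set u := x / 2; have -> : x = 2 * u by rewrite /u; field.
rewrite (_ : _ - _ = - (2 * ((sin u - u) * (sin u + u)))); last by field.
rewrite normrN normrM ger0_norm// normrM.
have -> : (2 * u) ^+ 4 / 8 = 2 * ((`|u| ^+ 3 / 2) * (`|u| + `|u|)).
  rewrite (_ : 2 * _ = 2 * (`|u| ^+ 2) ^+ 2); last by field.
  by rewrite (real_normK (num_real u)); field.
apply: ler_wpM2l => //; apply: ler_pM => //; first exact: sin_sub_id.
by rewrite (le_trans (ler_normD _ _))// lerD2r norm_sin_le.
Qed.

(** The map [a |-> 2 a ^ 2 - 1] is 4-Lipschitz on [[0, 1]], so one doubling costs a factor 4. It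
    depends on the cosine only through its absolute value. *)
Lemma cos_mulr2n_dist (a y e : R) :
  0 <= a <= 1 -> `|a - `|cos y| | <= e ->
  `|2 * a ^+ 2 - 1 - cos (y *+ 2)| <= 4 * e.
Proof.
move=> /andP[a0 a1] ae; set c := cos y in ae *.
have -> : cos (y *+ 2) = 2 * `|c| ^+ 2 - 1.
  by rewrite cos_mulr2n -/c real_normK ?num_real// mulr_natl.
rewrite (_ : _ - _ = 2 * ((a - `|c|) * (a + `|c|))); last by ring.
have c1 : `|c| <= 1 := cos_max _.
rewrite normrM ger0_norm// normrM (ger0_norm (_ : 0 <= a + `|c|)) ?addr_ge0//.
have := normr_ge0 (a - `|c|); have := normr_ge0 c; nra.
Qed.

Lemma iter_cos_mulr2n (a : nat -> R) (h e : R) :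
  (forall j, a j.+1 = `|2 * a j ^+ 2 - 1|) -> 0 <= a 0%N <= 1 ->
  `|a 0%N - `|cos h| | <= e ->
  forall j, 0 <= a j <= 1 /\ `|a j - `|cos (2 ^+ j * h)| | <= 4 ^+ j * e.
Proof.
move=> aS a01 a0e; elim=> [|j [aj01 IH]]; first by rewrite expr0 !mul1r.
rewrite aS normr_ge0 /=; split.
  by move/andP: aj01 => [? ?]; rewrite ler_norml; nra.
rewrite (le_trans (ler_dist_dist _ _))//.
rewrite (exprS 2) -(mulrA 2 _ h) (mulr_natl (2 ^+ j * h)) (exprS 4) -(mulrA 4).
exact: cos_mulr2n_dist.
Qed.

(* [doubling K c D / D ^ (2 ^ K)] is the [K]-th iterate of
   [a |-> |2 a ^ 2 - 1|] at [a = c / D]: the sign lost by the absolute value is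
   squared away at the next step. *)
Fixpoint doubling (K c D : nat) : nat :=
  if K is K'.+1 then
    let P := (2 * doubling K' c D ^ 2)%N in
    let E := (D ^ (2 ^ K))%N in (P - E + (E - P))%N
  else c.

Lemma recursive_doubling n (f g h : n.-tuple nat -> nat) :
  recursive f -> recursive g -> recursive h ->
  recursive (fun v => doubling (f v) (g v) (h v)).
Proof.
apply: recursive3.
apply: (@recursive_prim 2 (fun v => nth 0 v 0)%N
  (fun v => let P := (2 * (nth 0 v 1) ^ 2)%N in
    let E := (nth 0 v 3 ^ (2 ^ (nth 0 v 0).+1))%N in (P - E + (E - P))%N)) => //.
- exact: recursive_nth.
- have r0 := recursive_cst 4 2.
  apply: recursive_distn.
    by apply: recursiveM => //; apply: recursiveX => //; exact: recursive_nth.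
  apply: recursiveX; first exact: recursive_nth.
  by apply: recursiveX => //; exact/recursiveS/recursive_nth.
Qed.

Lemma doublingS_frac K c D : (0 < D)%N ->
  (doubling K.+1 c D)%:R / D%:R ^+ (2 ^ K.+1) =
  `|2 * ((doubling K c D)%:R / D%:R ^+ (2 ^ K)) ^+ 2 - 1| :> R.
Proof.
move=> D0; have E0 m : D%:R ^+ m != 0 :> R by rewrite expf_neq0// pnatr_eq0 -lt0n.
have D0' : 0 < D%:R ^+ (2 ^ K) :> R by rewrite exprn_gt0// ltr0n.
rewrite /= distn_natr natrM !natrX expnS mulnC exprM.
move: (D%:R ^+ _) D0' => E E_gt0; set P := (doubling _ _ _)%:R.
rewrite (_ : 2 * (P / E) ^+ 2 - 1 = (2 * P ^+ 2 - E ^+ 2) / E ^+ 2).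
  by rewrite normrM normfV (ger0_norm (sqr_ge0 E)).
by field; rewrite gt_eqF.
Qed.

(** For [z = d / b] and [h = z / 2 ^ (K + 1)], the start [|1 - h ^ 2 / 2|] is within [h ^ 4 / 8] of
    [|cos h|]. The [K + 1] doublings multiply this by [4 ^ (K + 1)], giving
    [z ^ 4 / (8 * 4 ^ (K + 1))]; as [z <= 2 ^ Z], the choice [K = k + 2 Z] brings it below [2 ^- k].
    The last doubling omits the absolute value and so recovers the sign. *)
Lemma cos_doubling_dist (k Z d b : nat) :
  let K := (k + 2 * Z)%N in
  let D := (2 * 4 ^ K.+1 * b ^ 2)%N in
  let P := doubling K (D - d ^ 2 + (d ^ 2 - D)) D in
  let E := (D ^ (2 ^ K.+1))%N in
  (0 < b)%N -> d%:R / b%:R <= 2 ^+ Z :> R ->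
  `|((2 * P ^ 2)%:R - E%:R) / E%:R - cos (d%:R / b%:R)| <= 2 ^- k :> R.
Proof.
move=> K D P E b0; set z := d%:R / b%:R => zZ.
pose w : R := 2 ^+ K.+1; pose h := z / w.
have w0 : 0 < w by rewrite exprn_gt0.
have b0' : 0 < b%:R :> R by rewrite ltr0n.
have z0 : 0 <= z by rewrite divr_ge0.
have D0 : (0 < D)%N by rewrite /D !muln_gt0 !expn_gt0 b0.
have w2 : 4 ^+ K.+1 = w ^+ 2 by rewrite /w exprAC; congr (_ ^+ _); rewrite -natrX.
have DE : D%:R = 2 * w ^+ 2 * b%:R ^+ 2 :> R.
  by rewrite /D natrM (natrM _ 2) natrX natrX w2.
pose a j : R := (doubling j (D - d ^ 2 + (d ^ 2 - D)) D)%:R / D%:R ^+ (2 ^ j).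
have aS j : a j.+1 = `|2 * a j ^+ 2 - 1| by exact: doublingS_frac.
have D0' : 0 < D%:R :> R by rewrite ltr0n.
(* The denominator [D] is chosen so that [d ^ 2 / D = h ^ 2 / 2]. *)
have a0 : a 0%N = `|1 - h ^+ 2 / 2|.
  rewrite /a expn0 expr1 /= distn_natr -[X in _ / X]gtr0_norm// -normfV -normrM.
  congr `|_|; rewrite natrX DE /h /z; field.
  by rewrite !gt_eqF.
have A0 : 0 < 2 ^+ Z :> R by rewrite exprn_gt0.
have B0 : 1 <= 2 ^+ k :> R by rewrite exprn_ege1// ler1n.
have wE : w = 2 * 2 ^+ k * (2 ^+ Z) ^+ 2.
  by rewrite /w /K exprS exprD mulrA -exprM mulnC.
have A1 : 1 <= 2 ^+ Z :> R by rewrite exprn_ege1// ler1n.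
have h0 : 0 <= h by rewrite divr_ge0// ltW.
have h1 : h <= 1.
  rewrite ler_pdivrMr// mul1r (le_trans zZ)// wE; nra.
have a01 : 0 <= a 0%N <= 1 by rewrite a0 normr_ge0 ler_norml /=; nra.
have a0e : `|a 0%N - `|cos h| | <= h ^+ 4 / 8.
  by rewrite a0 distrC (le_trans (ler_dist_dist _ _))// cos_sub_taylor2.
have [aK01 aKe] := iter_cos_mulr2n aS a01 a0e K.
have := cos_mulr2n_dist aK01 aKe.
have -> : (2 ^+ K * h) *+ 2 = z.
  by rewrite -mulr_natl mulrA -exprS /h mulrCA divff ?mulr1// gt_eqF.
have -> : 2 * a K ^+ 2 - 1 = ((2 * P ^ 2)%:R - E%:R) / E%:R.
  rewrite /a -/P /E natrM !natrX expnS mulnC exprM; field.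
  by rewrite expf_neq0// gt_eqF.
move/le_trans; apply; rewrite mulrA -exprS.
rewrite w2.
have -> : w ^+ 2 * (h ^+ 4 / 8) = (z / (2 ^+ Z)) ^+ 4 / (32 * 2 ^+ k) * (2 ^- k).
  rewrite /h wE; field.
  by rewrite !gt_eqF// (lt_le_trans ltr01).
rewrite -[leRHS]mul1r ler_wpM2r// ?invr_ge0 ?(le_trans ler01)//.
rewrite ler_pdivrMr; last by nra.
have : (z / 2 ^+ Z) ^+ 4 <= 1.
  by rewrite exprn_ile1 ?divr_ge0 ?(ltW A0)// ler_pdivrMr ?mul1r.
nra.
Qed.

(** Cosine is even, so only [|r w| = d w / b w] is needed. The factor 2 in the error counts the
    evaluation at a rational point and the replacement of [x] by its approximation. *)
Lemma computable_reals_cos n (x : n.-tuple nat -> R) :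
  computable_reals x -> computable_reals (fun v => cos (x v)).
Proof.
move=> /computable_realsP[r cr rx].
have [Z [rZ rleZ]] := recursive_frac_bound cr.
have [p [q [b [rp rq rb rE]]]] := cr.
pose d w := (p w - q w + (q w - p w))%N.
pose K w := (thead w + 2 * Z w)%N.
pose D w := (2 * 4 ^ (K w).+1 * b w ^ 2)%N.
pose P w := doubling (K w) (D w - d w ^ 2 + (d w ^ 2 - D w)) (D w).
pose E w := (D w ^ (2 ^ (K w).+1))%N.
have r2 : recursive (fun _ : n.+1.-tuple nat => 2%N) by exact: recursive_cst.
have rd : recursive d by exact: recursive_distn.
have rK : recursive K.
  by apply: recursiveD; [exact: recursive_thead|exact: recursiveM].
have rD : recursive D.
  apply: recursiveM; last exact: recursiveX.
  by apply: recursiveM => //; apply: recursiveX (recursiveS rK); exact: recursive_cst.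
have rP : recursive P.
  by apply: recursive_doubling => //; apply: recursive_distn => //; exact: recursiveX.
have rEE : recursive E by do 2?apply: recursiveX => //; exact: recursiveS.
apply: (@computable_reals_approx _ _ _
  (fun w => ((2 * P w ^ 2)%:R - (E w)%:R) / (E w)%:R) (fun=> 2%N)).
- exists (fun w => 2 * P w ^ 2)%N, E, E; split=> //.
    by apply: recursiveM => //; exact: recursiveX.
  move=> w; split=> //; have [b0 _] := rE w.
  by rewrite /E /D expn_gt0 !muln_gt0 !expn_gt0 b0.
- exact: recursive_cst.
- move=> k v; set w := [tuple of k :: v].
  have [b0 rwE] := rE w.
  have dE : (d w)%:R / (b w)%:R = `|r w|.
    by rewrite rwE distn_natr normrM normfV normr_nat.
  have zZ : (d w)%:R / (b w)%:R <= 2 ^+ Z w :> R.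
    by rewrite dE (le_trans (rleZ w))// ltW// ltr_nat_exp2.
  have := cos_doubling_dist k b0 zZ; rewrite dE cos_norm => cosr.
  have Kw : K w = (k + 2 * Z w)%N by rewrite /K theadE.
  rewrite -(subrK (cos (r w)) (_ / _)) -addrA (le_trans (ler_normD _ _))//.
  rewrite mulr_natl mulr2n; apply: lerD; first by move: cosr; rewrite -Kw.
  exact: le_trans (cos_dist _ _) (rx k v).
Qed.

(* [sin x * (sin h / h) = (cos (x - h) - cos (x + h)) / (2 h)] *)
Lemma computable_reals_sin n (x : n.-tuple nat -> R) :
  computable_reals x -> computable_reals (fun v => sin (x v)).
Proof.
move=> cx; pose h (w : n.+1.-tuple nat) : R := (2 ^ thead w)%:R^-1.
have rp : recursive (fun w : n.+1.-tuple nat => 2 ^ thead w)%N.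
  by apply: recursiveX; [exact: recursive_cst|exact: recursive_thead].
have cx' := computable_reals_map cx (@recursive_map_behead n).
have ch : computable_reals h.
  by apply/computable_reals_frac/recursive_frac_natV => // v; rewrite expn_gt0.
pose y (w : n.+1.-tuple nat) : R :=
  (cos (x [tuple of behead w] - h w) - cos (x [tuple of behead w] + h w)) *
  ((2 ^ thead w)%:R * 2%:R^-1).
apply: (@computable_reals_lim _ _ y _ (fun=> 1%N)).
- apply: computable_realsM.
    by apply: computable_realsB; apply: computable_reals_cos;
      [exact: computable_realsB|exact: computable_realsD].
  apply: computable_realsM; first exact: computable_reals_nat.
  by apply/computable_reals_frac/recursive_frac_natV => //; exact: recursive_cst.
- exact: recursive_cst.
- move=> k v; rewrite /y /h theadE.
  have -> : [tuple of behead [tuple of k :: v]] = v by exact: val_inj.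
  rewrite natrX mul1r; set e := 2 ^- k; set z := x v.
  have e0 : 0 < e by rewrite invr_gt0 exprn_gt0.
  have e1 : e <= 1 by rewrite invf_le1 ?exprn_gt0// exprn_ege1// ler1n.
  have -> : 2 ^+ k = e^-1 by rewrite /e invrK.
  rewrite cosB cosD (_ : _ - _ = sin z * ((sin e - e) / e)); last first.
    by field; rewrite gt_eqF.
  (* The relative error is at most [e ^ 2 / 2 <= e], because [e <= 1]. *)
  have se := sin_sub_id e; rewrite (ger0_norm (ltW e0)) in se.
  rewrite normrM -[leRHS]mul1r ler_pM// ?sin_max// normrM normfV (gtr0_norm e0).
  by rewrite ler_pdivrMr//; apply: (le_trans se); nra.
Qed.

End Trigonometry.

(** * Effective tightness *)

Section Search.
Context {R : realType}.

Lemma computable_seq_recursive n (x : nat -> R) (f : n.-tuple nat -> nat) :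
  computable_seq x -> recursive f -> computable_reals (fun v => x (f v)).
Proof.
move=> cx rf.
exact: computable_reals_map cx (recursive_map_cons rf (@recursive_map_nil n)).
Qed.

Lemma computable_dseq_recursive n (x : nat -> nat -> R)
    (f g : n.-tuple nat -> nat) :
  computable_dseq x -> recursive f -> recursive g ->
  computable_reals (fun v => x (f v) (g v)).
Proof.
move=> cx rf rg; exact: computable_reals_map cx
  (recursive_map_cons rf (recursive_map_cons rg (@recursive_map_nil n))).
Qed.

(* Strict inequality between computable reals is only semidecidable; it is
   enough to find [y] such that a rational approximation is small. *)
Lemma computable_reals_search n (x : n.+1.-tuple nat -> R) :
  computable_reals x ->
  (forall (k : nat) (v : n.-tuple nat), exists y, x [tuple of y :: v] < 2 ^- k) ->
  exists2 s : n.+1.-tuple nat -> nat, recursive s &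
    forall (k : nat) (v : n.-tuple nat),
      x [tuple of s [tuple of k :: v] :: v] <= 2 ^- k.
Proof.
move=> /computable_realsP[r [p [q [b [rp rq rb rE]]]] rx] exx.
(* Precision [k + 2] against the threshold [2 ^- (k + 1)]: any [y] with [x < 2 ^- (k + 2)] passes
   the test, so the search ends, and any [y] that passes satisfies [x <= 2 ^- (k + 1) + 2 ^- (k + 2)
   <= 2 ^- k]. *)
pose w (y : nat) (u : n.+1.-tuple nat) : n.+2.-tuple nat :=
  [tuple of (thead u).+2 :: [tuple of y :: [tuple of behead u]]].
(* [r (w y u) <= 2 ^- (thead u).+1], cleared of denominators *)
pose Q y u :=
  (p (w y u) * 2 ^ (thead u).+1 <= b (w y u) + q (w y u) * 2 ^ (thead u).+1)%N.
have QE y u : Q y u = (r (w y u) <= 2 ^- (thead u).+1).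
  have [b0 ->] := rE (w y u).
  rewrite ler_pdivrMr ?ltr0n// mulrC ler_pdivlMr ?exprn_gt0// mulrBl lerBlDr.
  by rewrite /Q -natrX -!natrM -natrD ler_nat.
have half k : 2 ^- k.+1 + 2 ^- k.+1 = 2 ^- k :> R.
  by rewrite exprS invfM -mulrDl; field; rewrite expf_neq0.
have exQ u : exists y, Q y u.
  have [y xy] := exx (thead u).+2 [tuple of behead u].
  exists y; rewrite QE -half -(subrK (x [tuple of y :: [tuple of behead u]]) (r _)).
  rewrite lerD ?(ltW xy)//; exact: le_trans (ler_norm _) (rx _ _).
exists (fun u => ex_minn (exQ u)).
  have rw : recursive_map (fun u : n.+2.-tuple nat => w (thead u) [tuple of behead u]).
    have rt := recursive_map_comp (recursive_thead n) (@recursive_map_behead n.+1).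
    apply: recursive_map_cons; first by do 2 apply: recursiveS.
    apply: recursive_map_cons; first exact: recursive_thead.
    move=> i; exact: recursive_map_comp (@recursive_map_behead n i)
      (@recursive_map_behead n.+1).
  have re : recursive (fun u : n.+2.-tuple nat => 2 ^ (thead [tuple of behead u]).+1)%N.
    apply: recursiveX; first exact: recursive_cst.
    by apply/recursiveS/(recursive_map_comp (recursive_thead n))/recursive_map_behead.
  apply: recursive_ex_minn; apply: recursive_leq.
    by apply: recursiveM => //; exact: recursive_map_comp rp rw.
  apply: recursiveD; first exact: recursive_map_comp rb rw.
  by apply: recursiveM => //; exact: recursive_map_comp rq rw.
move=> k v; case: ex_minnP => y; rewrite QE /w theadE => ry _.
have vE : [tuple of behead [tuple of k :: v]] = v by exact: val_inj.
rewrite vE in ry; rewrite -half -(subrK (r [tuple of k.+2 :: [tuple of y :: v]]) (x _)).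
apply: lerD => //; apply: le_trans (ler_norm _) _; rewrite distrC.
by apply: (le_trans (rx _ _)); apply: ler_exp2V.
Qed.

End Search.

(** * Tent functions as cut-offs *)

Section Tent.
Context {R : realType}.
Implicit Types (L : nat) (x y : R).

(* [min 1 (max 0 u)] for [u = L + 1 - |x|] *)
Definition tent L x : R :=
  (`|L.+1%:R - `|x| | - `|L%:R - `|x| | + 1) / 2.

Variant tent_spec L x : R -> Prop :=
  | TentIn of `|x| <= L%:R : tent_spec L x 1
  | TentSlope of L%:R <= `|x| & `|x| <= L.+1%:R : tent_spec L x (L.+1%:R - `|x|)
  | TentOut of L.+1%:R <= `|x| : tent_spec L x 0.

Lemma tentP L x : tent_spec L x (tent L x).
Proof.
rewrite /tent; have L1 : L.+1%:R = L%:R + 1 :> R by rewrite natr1.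
have [xL|/ltW Lx] := leP `|x| L%:R.
  rewrite (ger0_norm (_ : 0 <= L.+1%:R - _)); last by lra.
  rewrite (ger0_norm (_ : 0 <= L%:R - _)); last by lra.
  by rewrite L1 (_ : _ / 2 = 1); [exact: TentIn|field].
rewrite (ler0_norm (_ : L%:R - _ <= 0)); last by lra.
have [xL|/ltW Lx'] := leP `|x| L.+1%:R.
  rewrite (ger0_norm (_ : 0 <= L.+1%:R - _)); last by lra.
  by rewrite (_ : _ / 2 = L.+1%:R - `|x|); [exact: TentSlope|rewrite L1; field].
rewrite (ler0_norm (_ : L.+1%:R - _ <= 0)); last by lra.
by rewrite (_ : _ / 2 = 0); [exact: TentOut|rewrite L1; field].
Qed.

Lemma tent_ge0 L x : 0 <= tent L x.
Proof. by case: tentP => // _; rewrite subr_ge0. Qed.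

Lemma tent_le1 L x : tent L x <= 1.
Proof. by case: tentP => // Lx _; rewrite -natr1; lra. Qed.

Lemma tent_in L x : `|x| <= L%:R -> tent L x = 1.
Proof. by case: tentP => //; rewrite -natr1 => *; lra. Qed.

Lemma tent_out L x : L.+1%:R <= `|x| -> tent L x = 0.
Proof. by case: tentP => //; rewrite -natr1 => *; lra. Qed.

(** Bounds the factor [|x|] that differentiating [h (t * x)] in [t] produces. *)
Lemma tent_mul_norm L x : tent L x * `|x| <= L.+1%:R.
Proof.
have := tent_ge0 L x; have := tent_le1 L x; have := normr_ge0 x; have := ler0n R L.
by case: tentP; rewrite -natr1 => *; nra.
Qed.

Lemma tent_dist L x y : `|tent L x - tent L y| <= `|x - y|.
Proof.
have dist_sub (a : R) : `| `|a - `|x| | - `|a - `|y| | | <= `|x - y|.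
  rewrite (le_trans (ler_dist_dist _ _))// opprB addrC addrA subrK distrC.
  exact: ler_dist_dist.
rewrite /tent (_ : _ - _ = ((`|L.+1%:R - `|x| | - `|L.+1%:R - `|y| |)
  - (`|L%:R - `|x| | - `|L%:R - `|y| |)) / 2); last by field.
rewrite normrM normfV normr_nat ler_pdivrMr// mulr_natr mulr2n.
by rewrite (le_trans (ler_normB _ _))// lerD.
Qed.

Lemma lipschitz_continuous (f : R -> R) (M : R) :
  (forall x y, `|f x - f y| <= M * `|x - y|) -> continuous f.
Proof.
move=> fM x; apply/cvgrPdist_le => e e0.
have M0 : 0 < `|M| + 1 by rewrite ltr_wpDl.
near=> y.
rewrite (le_trans (fM _ _))// (@le_trans _ _ ((`|M| + 1) * `|x - y|))//.
  by rewrite ler_wpM2r// (le_trans (ler_norm _))// lerDl.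
rewrite mulrC -ler_pdivlMr//; near: y.
by apply: cvgr_dist_le => //; rewrite divr_gt0.
Unshelve. all: by end_near. Qed.

(** Comparison of computable reals is undecidable; writing [tent] with absolute values avoids any
    case distinction. *)
Lemma computable_reals_tent n (f : n.-tuple nat -> nat) (x : n.-tuple nat -> R) :
  recursive f -> computable_reals x ->
  computable_reals (fun v => tent (f v) (x v)).
Proof.
move=> rf cx; have cx' := computable_reals_norm cx.
have c1 : computable_reals (fun _ : n.-tuple nat => 1 : R).
  exact: (computable_reals_nat (recursive_cst n 1)).
apply: computable_realsM.
  apply: computable_realsD => //; apply: computable_realsB;
    apply: computable_reals_norm; apply: computable_realsB => //;
    apply: computable_reals_nat => //; exact: recursiveS.
by apply/computable_reals_frac/recursive_frac_natV => //; exact: recursive_cst.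
Qed.

End Tent.

(** * Tightness with a recursive cut-off *)

Section Tightness.
Local Open Scope classical_set_scope.
Context {R : realType}.
Notation rprob := (probability (measurableTypeR R) R).

Lemma bounded_integrable (mu : rprob) (f : R -> R) (M : R) :
  continuous f -> (forall x, `|f x| <= M) -> mu.-integrable setT (EFin \o f).
Proof.
move=> cf fM; apply: measurable_bounded_integrable => //.
- by rewrite -ge0_fin_numE// fin_num_measure.
- exact: continuous_measurable_fun.
- by exists M; split; [exact: num_real|move=> y My x _; exact: le_trans (fM x) (ltW My)].
Qed.

Lemma probability_cst (mu : rprob) (a : R) : \int[mu]_x a = a.
Proof.
rewrite Rintegral_cst// [X in fine X](_ : _ = 1%E) ?mulr1//.
exact: probability_setT.
Qed.

Lemma continuous_tent L : continuous (@tent R L).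
Proof. by apply: (@lipschitz_continuous _ _ 1) => x y; rewrite mul1r tent_dist. Qed.

Lemma tent_integrable (mu : rprob) L : mu.-integrable setT (EFin \o tent L).
Proof.
apply: (@bounded_integrable _ _ 1); first exact: continuous_tent.
by move=> x; rewrite ger0_norm ?tent_ge0 ?tent_le1.
Qed.

(** Continuity from below along the intervals [[-L, L]], whose indicators lie below [tent L]. This
    gives no rate; it only guarantees that the search for [L] terminates. *)
Lemma probability_tight (mu : rprob) (e : R) :
  0 < e -> exists L, 1 - \int[mu]_x tent L x < e.
Proof.
move=> e0; pose F L : set R := [set x | `|x| <= L%:R].
have mF L : measurable (F L : set (measurableTypeR R)).
  rewrite (_ : F L = `[- L%:R, L%:R]%classic); first exact: measurable_itv.
  by apply/seteqP; split=> x /=; rewrite /F /= in_itv/= ler_norml.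
have UF : \bigcup_L F L = setT.
  apply/seteqP; split=> // x _; exists (Num.bound `|x|) => //.
  by rewrite /F /= ltW// archi_boundP.
have : mu \o F @ \oo --> mu (\bigcup_L F L).
  apply: nondecreasing_cvg_mu => //; first by rewrite UF; exact: measurableT.
  move=> a b ab; apply/subsetPset => x; rewrite /F /= => /le_trans; apply.
  by rewrite ler_nat.
rewrite UF [X in _ --> X](_ : _ = 1%E); last exact: probability_setT.
move=> /fine_cvgP[_ /cvgrPdist_lt/(_ _ e0)[L _ /(_ L (leqnn L))]].
rewrite /= => Le; exists L; apply: le_lt_trans Le; rewrite /=.
rewrite (le_trans _ (ler_norm _))// lerD2l lerN2.
have -> : fine (mu (F L)) = \int[mu]_x \1_(F L) x.
  by rewrite /Rintegral integral_indic// setIT.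
apply: le_Rintegral => //.
- by apply: integrable_indic => //; rewrite -ge0_fin_numE// fin_num_measure.
- exact: tent_integrable.
- move=> x _; rewrite indicE; have [|_] := boolP (x \in F L); last exact: tent_ge0.
  by rewrite inE => xL; rewrite tent_in.
Qed.

Lemma computable_distrs_tent (mu : nat -> rprob) :
  computable_distrs mu -> computable_dseq (fun m L => \int[mu m]_x tent L x).
Proof.
move=> cmu; apply: cmu; split; last first.
  exists S; split; first exact/recursiveS/recursive_nth.
  by move=> L x; exact: tent_out.
split=> [x cx|].
  apply: computable_reals_tent; first exact: recursive_nth.
  by apply: computable_seq_recursive => //; exact: recursive_nth.
(* All tents are 1-Lipschitz, so the modulus is the same for all of them. *)
exists (fun _ _ k => k); split; first exact: recursive_nth.
by move=> L _ k x y xy _ _; rewrite (le_lt_trans _ xy)// tent_dist.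
Qed.

Lemma computable_distrs_tight (mu : nat -> rprob) :
  computable_distrs mu ->
  exists2 L : nat -> nat -> nat, recursive (uncurry2 L) &
    forall m k, 1 - \int[mu m]_x tent (L m k) x <= 2 ^- k.
Proof.
move=> /computable_distrs_tent cT.
(* The search runs over the leading coordinate, so the cut-off precedes [m]. *)
pose y (w : 2.-tuple nat) := 1 - \int[mu (nth 0%N w 1)]_x tent (nth 0%N w 0) x.
have [||s rs sy] := @computable_reals_search _ _ y.
- apply: computable_realsB; first exact: (computable_reals_nat (recursive_cst 2 1)).
  by apply: computable_dseq_recursive cT _ _; exact: recursive_nth.
- move=> k v; have [|L HL] := @probability_tight (mu (nth 0%N v 0)) (2 ^- k).
    by rewrite invr_gt0 exprn_gt0.
  by exists L.
exists (fun m k => s [tuple k; m]) => [|m k]; last exact: (sy k [tuple m]).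
apply: recursive_map_comp rs _; do 2 apply: recursive_map_cons (recursive_nth _ _) _.
exact: recursive_map_nil.
Qed.

End Tightness.
(** * Characteristic functions *)

(* Instantiated with [h = cos] and [h = sin], for the real and imaginary parts
   of the characteristic functions. *)
Section Dilation.
Context {R : realType}.
Notation rprob := (probability (measurableTypeR R) R).
Variable h : R -> R.
Hypothesis h_le1 : forall x, `|h x| <= 1.
Hypothesis h_dist : forall x y, `|h x - h y| <= `|x - y|.
Hypothesis computable_h : forall n (x : n.-tuple nat -> R),
  computable_reals x -> computable_reals (fun v => h (x v)).

Lemma continuous_dilation (t : R) : continuous (fun x : R => h (t * x)).
Proof.
apply: (@lipschitz_continuous _ _ `|t|) => x y.
by rewrite (le_trans (h_dist _ _))// -mulrBr normrM.
Qed.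

Lemma dilation_integrable (mu : rprob) t :
  mu.-integrable setT (EFin \o (fun x => h (t * x))).
Proof. by apply: (bounded_integrable _ (M := 1)) => //; exact: continuous_dilation. Qed.

Lemma tent_dilation_dist (L : nat) (t x y : R) :
  `|tent L x * h (t * x) - tent L y * h (t * y)| <= (1 + `|t|) * `|x - y|.
Proof.
rewrite (_ : _ - _ = (tent L x - tent L y) * h (t * x)
  + tent L y * (h (t * x) - h (t * y))); last by ring.
rewrite (le_trans (ler_normD _ _))// normrM (normrM (tent L y)) mulrDl.
apply: lerD.
  by rewrite mul1r -[leRHS]mulr1; apply: ler_pM => //; exact: tent_dist.
rewrite -[leRHS]mul1r; apply: ler_pM => //.
  by rewrite ger0_norm ?tent_ge0 ?tent_le1.
by rewrite (le_trans (h_dist _ _))// -mulrBr normrM.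
Qed.

Lemma tent_dilation_integrable (mu : rprob) L t :
  mu.-integrable setT (EFin \o (fun x => tent L x * h (t * x))).
Proof.
apply: (bounded_integrable _ (M := 1)).
  exact: lipschitz_continuous (tent_dilation_dist L t).
move=> x; rewrite normrM ger0_norm ?tent_ge0//.
by rewrite mulr_ile1// ?tent_ge0 ?tent_le1.
Qed.

(** The index [p] codes the pair [(n, L)]. The support ends at [L + 1], and the Lipschitz constant
    [1 + |t n|] has a bound recursive in [n]. *)
Lemma computable_funs_tent_dilation (t : nat -> R) :
  computable_seq t ->
  computable_funs_cpt
    (fun p x => tent (unpair2 p) x * h (t (unpair1 p) * x)).
Proof.
move=> ct; have [B [rB tB]] := computable_reals_bound ct.
have rp1 n i : recursive (fun v : n.-tuple nat => unpair1 (nth 0%N v i)).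
  exact/recursive_unpair1/recursive_nth.
have rp2 n i : recursive (fun v : n.-tuple nat => unpair2 (nth 0%N v i)).
  exact/recursive_unpair2/recursive_nth.
split; last first.
  exists (fun p => (unpair2 p).+1); split; first exact: recursiveS.
  by move=> p x px; rewrite tent_out// mul0r.
split=> [x cx|].
  have cx1 : computable_reals (fun v : 2.-tuple nat => x (nth 0%N v 1)).
    by apply: computable_seq_recursive => //; exact: recursive_nth.
  apply: computable_realsM; first exact: computable_reals_tent.
  by apply: computable_h; apply: computable_realsM => //; exact: computable_seq_recursive.
pose C p := (B [tuple unpair1 p]).+1.
exists (fun p _ k => (k + C p)%N); split.
  apply: recursiveD; first exact: recursive_nth.
  apply/recursiveS/(recursive_map_comp rB)/recursive_map_cons => //.
  exact: recursive_map_nil.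
move=> p _ k x y xy _ _; rewrite (le_lt_trans (tent_dilation_dist _ _ _ _))//.
apply: lt_le_trans (mulr_nat_exp2V (C p) k).
have tC : 1 + `|t (unpair1 p)| <= (C p)%:R.
  by rewrite /C -natr1 addrC lerD2r; exact: (tB [tuple unpair1 p]).
rewrite (@le_lt_trans _ _ ((C p)%:R * `|x - y|))//; first by rewrite ler_wpM2r.
by rewrite ltr_pM2l// ltr0n.
Qed.

(** The integrands differ by [(1 - tent L x) * h (t * x)]; total mass 1 turns the constant 1 on the
    right into an integral, so that monotonicity applies. *)
Lemma dilation_truncation (mu : rprob) L t :
  `|\int[mu]_x (tent L x * h (t * x)) - \int[mu]_x h (t * x)| <=
  1 - \int[mu]_x tent L x.
Proof.
have it := tent_integrable mu L; have ih := dilation_integrable mu t.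
have ith := tent_dilation_integrable mu L t.
have i1 : mu.-integrable setT (EFin \o (fun=> 1 : R)).
  by apply: (bounded_integrable _ (M := 1)) => [x|x]; [exact: cvg_cst|rewrite normr1].
rewrite -RintegralB// -[X in X - _](probability_cst mu) -RintegralB//.
rewrite (le_trans (le_normr_Rintegral _ _))//.
  exact: (integrableB _ ith ih).
apply: le_Rintegral => //.
- exact: (integrable_norm (integrableB _ ith ih)).
- exact: (integrableB _ i1 it).
- move=> x _; rewrite (_ : _ - _ = - ((1 - tent L x) * h (t * x))); last by ring.
  rewrite normrN normrM ger0_norm ?subr_ge0 ?tent_le1// -[leRHS]mulr1.
  by rewrite ler_wpM2l ?subr_ge0 ?tent_le1.
Qed.

Lemma computable_dilation (mu : nat -> rprob) (t : nat -> R) :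
  computable_distrs mu -> computable_seq t ->
  computable_dseq (fun m n => \int[mu m]_x h (t n * x)).
Proof.
move=> cmu ct; have [L rL tight] := computable_distrs_tight cmu.
have cf := cmu _ (computable_funs_tent_dilation ct).
have r0 := recursive_nth 3.
have rLw : recursive (fun w : 3.-tuple nat => L (nth 0 w 1) (nth 0 w 0))%N.
  exact: recursive2.
(* For [w = (k, m, n)], the test function integrated against [mu m] is the one with code
   [pairn n (L m k)]. *)
have cF := computable_dseq_recursive cf (r0 1%N) (recursive_pairn (r0 2) rLw).
apply: (computable_reals_lim cF (recursive_cst _ 1)) => k v.
rewrite mul1r /uncurry2 /=.
under eq_Rintegral do rewrite pairnK1 pairnK2.
exact: le_trans (dilation_truncation _ _ _) (tight _ _).
Qed.

(** No first moment is available, so [|a - b|] is split by the weights [tent L] and [1 - tent L]: on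
    the first part the Lipschitz bound [|t - s| * |x|] is tamed by the cut-off, on the second
    [|a - b| <= 2]. *)
Lemma dilation_dist (mu : rprob) L t s :
  `|\int[mu]_x h (t * x) - \int[mu]_x h (s * x)| <=
  L.+1%:R * `|t - s| + 2 * (1 - \int[mu]_x tent L x).
Proof.
have it := tent_integrable mu L.
have iht := dilation_integrable mu t; have ihs := dilation_integrable mu s.
have ic (c : R) : mu.-integrable setT (EFin \o (fun=> c)).
  by apply: (bounded_integrable _ (M := `|c|)) => [x|x //]; exact: cvg_cst.
have i1t := integrableB measurableT (ic 1) it.
have i21t : mu.-integrable setT (EFin \o (fun x => 2 * (1 - tent L x))).
  exact: (integrableZl measurableT 2 i1t).
rewrite -RintegralB// -[X in 2 * (X - _)](probability_cst mu) -RintegralB//.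
rewrite -RintegralZl// -[X in X + _](probability_cst mu) -RintegralD//.
have ihts := integrableB measurableT iht ihs.
rewrite (le_trans (le_normr_Rintegral _ _))//.
apply: le_Rintegral => //; first exact: integrable_norm.
  exact: (integrableD measurableT (ic _) i21t).
move=> x _; set a := h _; set b := h _.
have ab2 : `|a - b| <= 2.
  by rewrite (le_trans (ler_normB _ _))// [leRHS]mulr2n; apply: lerD; exact: h_le1.
have abL : `|a - b| <= `|t - s| * `|x|.
  by rewrite (le_trans (h_dist _ _))// -mulrBl normrM.
have t0 := tent_ge0 L x; have t1 := tent_le1 L x; have tL := tent_mul_norm L x.
have -> : `|a - b| = tent L x * `|a - b| + (1 - tent L x) * `|a - b| by ring.
apply: lerD; last by rewrite mulrC ler_wpM2r// subr_ge0.
rewrite (@le_trans _ _ (`|t - s| * (tent L x * `|x|)))//.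
  by rewrite mulrCA ler_wpM2l.
by rewrite mulrC ler_wpM2r.
Qed.

End Dilation.

Section CharFun.
Context {R : realType}.
Local Open Scope complex_scope.
Notation rprob := (probability (measurableTypeR R) R).

Lemma char_funE (mu : rprob) (t : R) :
  char_fun mu t = (\int[mu]_x cos (t * x)) +i* (\int[mu]_x sin (t * x)).
Proof.
rewrite /char_fun /cintegral /cexp; congr (_ +i* _); apply: eq_Rintegral => x _ /=;
  by rewrite !(mul0r, mulr0, mul1r, subr0, addr0, add0r, oppr0, sub0r, expR0).
Qed.

Lemma complex_norm_le (z : R[i]) :
  `|z| <= (`|complex.Re z| + `|complex.Im z|)%:C.
Proof.
rewrite normc_def lecR -[leRHS]ger0_norm ?addr_ge0// -sqrtr_sqr ler_wsqrtr//.
rewrite sqrrD !real_normK ?num_real// addrAC lerDl.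
by rewrite mulrn_wge0// mulr_ge0.
Qed.

End CharFun.

Theorem theorem4p1 (R : realType)
    (mu : nat -> probability (measurableTypeR R) R) :
  computable_distrs mu ->
  uniformly_computable (fun m => char_fun (mu m)).
Proof.
move=> cmu; split=> [t ct|].
  split.
    under eq_fun do under eq_fun do rewrite char_funE /=.
    apply: computable_dilation => //;
      [exact: cos_max|exact: cos_dist|exact: computable_reals_cos].
  under eq_fun do under eq_fun do rewrite char_funE /=.
  apply: computable_dilation => //;
    [exact: sin_max|exact: sin_dist|exact: computable_reals_sin].
have [L rL tight] := computable_distrs_tight cmu.
(* Each of the real and imaginary parts gets less than [2 ^- k / 4] from [(L + 1) |t - s|] and at
   most [2 * 2 ^- (k + 3) = 2 ^- k / 4] from the tail; the four contributions add up to less than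
   [2 ^- k]. *)
exists (fun m k => k.+2 + (L m k.+3).+1)%N; split.
  have r0 := recursive_nth 2.
  apply: recursiveD; first by do 2 apply: recursiveS.
  by apply: recursiveS; apply: recursive2 => //; do 3 apply: recursiveS.
move=> m k t s ts; rewrite (le_lt_trans (complex_norm_le _))//.
have -> : (2 ^- k : R[i]) = ((2 ^- k)%:C)%C by rewrite fmorphV rmorphXn rmorphMn.
rewrite ltcR !char_funE /=; set l := L m k.+3 in ts *.
have dc := dilation_dist (@cos_max R) cos_dist (mu m) l t s.
have ds := dilation_dist (@sin_max R) sin_dist (mu m) l t s.
rewrite (le_lt_trans (lerD dc ds))//.
have := tight m k.+3; rewrite -/l => tl.
have lts : l.+1%:R * `|t - s| < 2 ^- k.+2.
  by apply: lt_le_trans (mulr_nat_exp2V l.+1 k.+2); rewrite ltr_pM2l// ltr0n.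
have e3 : 2 ^- k.+2 = 2 ^- k / 4 :> R by rewrite !exprS; field; rewrite expf_neq0.
have e4 : 2 ^- k.+3 = 2 ^- k / 8 :> R by rewrite !exprS; field; rewrite expf_neq0.
rewrite e3 in lts; rewrite e4 in tl; lra.
Qed.
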